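(* Assume (A1) and (A2). In addition, suppose that $H$ and $\sigma$ are of class $C^2$. Let $(t_0,x_0)\in\Omega$, $y_0\in\ell^*(t_0,x_0)$, and let $$\mathcal C:\ x=x(t)=x_0+\int_{t_0}^tH_p(\tau,\sigma_y(y_0))\,d\tau$$ be a characteristic curve of type (II) at $(t_0,x_0)$. Then there exists $\theta\in(0,t_0)$ such that $\mathcal C$ is of type (I) at $(\theta,x(\theta))$ and $\mathcal C$ is of type (II) at every point $(t,x)\in\mathcal C$ with $t\in(\theta,t_0]$.
   Context: Let $T>0$ and $\Omega=(0,T)\times\mathbb R^n$. Let $H=H(t,p)$ be a real-valued function on $[0,T]\times\mathbb R^n$ and $\sigma:\mathbb R^n\to\mathbb R$ be convex. $\sigma^*:\mathbb R^n\to\mathbb R\cup\{+\infty\}$ is the Fenchel conjugate of $\sigma$; $H_p$ is the gradient of $H$ in $p$ and $\sigma_y$ the gradient of $\sigma$. Condition (A1): for every $(t_0,x_0)\in[0,T)\times\mathbb R^n$ there exist positive constants $r$ and $N$ such that $$\langle x,p\rangle-\sigma^*(p)-\int_0^tH(\tau,p)\,d\tau<\max_{|q|\le N}\Big\{\langle x,q\rangle-\sigma^*(q)-\int_0^tH(\tau,q)\,d\tau\Big\}$$ whenever $(t,x)\in[0,T)\times\mathbb R^n$, $|t-t_0|+|x-x_0|<r$ and $|p|>N$. Condition (A2): $H$ has one of the two following forms: a) $H(t,\cdot)$ is convex for all $t\in(0,T)$, or $H(t,\cdot)$ is concave for all $t\in(0,T)$; b) $H(t,p)=g(t)h(p)+k(t)$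 for some functions $g,h,k$, where $g(t)$ does not change its sign on $(0,T)$. For $(t,x)\in\Omega$, $\ell(t,x)$ is the set of all $p\in\mathbb R^n$ at which the function $q\mapsto\langle x,q\rangle-\sigma^*(q)-\int_0^tH(\tau,q)\,d\tau$ attains its maximum over $\mathbb R^n$. For $y\in\mathbb R^n$, the characteristic curve emanating from $(0,y)$ is $x=y+\int_0^tH_p(\tau,\sigma_y(y))\,d\tau$, $t\in[0,T]$. For $(t_0,x_0)\in\Omega$, $\ell^*(t_0,x_0)$ is the set of all $y$ such that the characteristic curve emanating from $(0,y)$ passes through $(t_0,x_0)$; this curve can then be written $x=x_0+\int_{t_0}^tH_p(\tau,\sigma_y(y))\,d\tau$, $t\in[0,T]$. Such a characteristic curve is of type (I) at $(t_0,x_0)$ if $\sigma_y(y)\in\ell(t_0,x_0)$, and of type (II) at $(t_0,x_0)$ if $\sigma_y(y)\in\sigma_y(\ell^*(t_0,x_0))\setminus\ell(t_0,x_0)$. The same definition applies at any other point of $\Omega$ on the curve. *)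

(* Defs.v *)
From HB Require Import structures.
From mathcomp Require Import all_boot all_order all_algebra.
From mathcomp Require Import all_classical all_reals all_analysis.

Set Implicit Arguments.
Unset Strict Implicit.
Unset Printing Implicit Defensive.

Import Order.TTheory GRing.Theory Num.Theory.
Import numFieldNormedType.Exports.

Local Open Scope classical_set_scope.
Local Open Scope ring_scope.

Section euclidean.
Context {R : realType} {n : nat}.

Definition dotp (x y : 'rV[R]_n) : R := \sum_(i < n) x 0 i * y 0 i.

(* The norm `|x| provided by the library on 'rV[R]_n is the sup norm. *)
Definition enorm (x : 'rV[R]_n) : R := Num.sqrt (dotp x x).

Definition grad (f : 'rV[R]_n -> R) (x : 'rV[R]_n) : 'rV[R]_n :=
  \row_(i < n) 'D_(delta_mx 0 i) (f : 'rV[R]_n -> R^o) x.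

End euclidean.

Section smoothness.
Context {R : realType} {V : normedModType R}.

(* For finite-dimensional V and open U this is the usual class C^k on U:
   having continuous directional derivatives in all directions up to order k is
   the same as having continuous partial derivatives up to order k. *)
Fixpoint Ck_open (k : nat) (U : set V) (f : V -> R^o) : Prop :=
  (forall x, U x -> {for x, continuous f}) /\
  if k is k'.+1 then
    forall v : V, (forall x, U x -> derivable f x v) /\ Ck_open k' U ('D_v f)
  else True.

(* Class C^k on a subset A that need not be open: f is the restriction to A
   of a function of class C^k on an open neighbourhood of A. *)
Definition Ck_on (k : nat) (A : set V) (f : V -> R) : Prop :=
  exists U : set V, exists g : V -> R,
    [/\ open U, A `<=` U, Ck_open k U g & forall x, A x -> f x = g x].

End smoothness.

Section oriented_integral.
Context {R : realType}.

Definition oint (a b : R) (f : R -> R) : R :=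
  if a <= b then \int[lebesgue_measure]_(s in `[a, b]) f s
  else - \int[lebesgue_measure]_(s in `[b, a]) f s.

Definition ointv {n : nat} (a b : R) (f : R -> 'rV[R]_n) : 'rV[R]_n :=
  \row_(i < n) oint a b (fun s => f s 0 i).

End oriented_integral.

Definition is_maximum {R : realType} (S : set (\bar R)) (m : \bar R) : Prop :=
  S m /\ ubound S m.

Section hopf.
Context {R : realType} {n : nat}.
(* Only the values H t p with t in [0, T] are meaningful. *)
Variables (H : R -> 'rV[R]_n -> R) (sigma : 'rV[R]_n -> R).

Definition conjugate (p : 'rV[R]_n) : \bar R :=
  ereal_sup [set (dotp y p - sigma y)%:E | y in [set: 'rV[R]_n]].

Definition hopf_fun (t : R) (x q : 'rV[R]_n) : \bar R :=
  ((dotp x q)%:E - conjugate q - (oint 0 t (fun s => H s q))%:E)%E.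

Definition condA1 (T : R) : Prop :=
  forall (t0 : R) (x0 : 'rV[R]_n), 0 <= t0 < T ->
  exists r N : R, [/\ 0 < r, 0 < N &
    forall (t : R) (x p : 'rV[R]_n),
      0 <= t < T -> `|t - t0| + enorm (x - x0) < r -> N < enorm p ->
      exists2 m : \bar R,
        is_maximum [set hopf_fun t x q | q in [set q | enorm q <= N]] m &
        (hopf_fun t x p < m)%E].

Definition condA2 (T : R) : Prop :=
  [\/ (forall t, 0 < t < T -> convex_function setT (H t)) \/
      (forall t, 0 < t < T -> convex_function setT (fun p => - H t p)) |
      exists (g : R -> R) (h : 'rV[R]_n -> R) (k : R -> R),
        (forall t p, 0 <= t <= T -> H t p = g t * h p + k t) /\
        ((forall t, 0 < t < T -> 0 <= g t) \/
         (forall t, 0 < t < T -> g t <= 0))].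

Definition ell (t : R) (x : 'rV[R]_n) : set 'rV[R]_n :=
  [set p | forall q, (hopf_fun t x q <= hopf_fun t x p)%E].

Definition char_curve (y : 'rV[R]_n) (t : R) : 'rV[R]_n :=
  y + ointv 0 t (fun s => grad (H s) (grad sigma y)).

Definition ell_star (t : R) (x : 'rV[R]_n) : set 'rV[R]_n :=
  [set y | char_curve y t = x].

(* Type, at the point (t, x), of the characteristic curve emanating from
   (0, y), which is assumed to pass through (t, x). *)
Definition type_I (y : 'rV[R]_n) (t : R) (x : 'rV[R]_n) : Prop :=
  ell t x (grad sigma y).

Definition type_II (y : 'rV[R]_n) (t : R) (x : 'rV[R]_n) : Prop :=
  ((grad sigma @` ell_star t x) `\` ell t x) (grad sigma y).

End hopf.

(* Main.v *)
Require Import Defs.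
From HB Require Import structures.
From mathcomp Require Import all_boot all_order all_algebra.
From mathcomp Require Import all_classical all_reals all_analysis.
From mathcomp Require Import ring lra.

Set Implicit Arguments.
Unset Strict Implicit.
Unset Printing Implicit Defensive.

Import Order.TTheory GRing.Theory Num.Theory.
Import numFieldNormedType.Exports.

Local Open Scope classical_set_scope.
Local Open Scope ring_scope.

(** Write [p0] for the gradient of [sigma] at [y0] and [E(s, q)] for the Bregman
    excess [H(s, q) - H(s, p0) - <H_p(s, p0), q - p0>].  Along the characteristic
    from [(0, y0)], the Hopf function at [p0] minus the Hopf function at [q] is
    [D(q) + int_0^t E(s, q) ds], where
    [D(q) = sigma^*(q) - sigma^*(p0) - <y0, q - p0> >= 0], so the curve is of
    type (I) at time [t] iff these quantities are all nonnegative.  By (A2),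
    [E(., q)] has a constant sign on [(0, T)] for each [q], hence type (I)
    propagates to smaller times; it also passes to limits in [t].  The point
    [theta] is the last time of type (I), and it is positive because type (I)
    holds for small [t]: by (A1) near [(0, y0)] only bounded [q] matter, and for
    those [D(q) >= b |q - p0|^2] since [sigma] is C^2, whereas
    [|E(s, q)| <= K |q - p0|^2] since [H] is C^2. *)

(** * Dot product, Euclidean norm and its comparison with the sup norm *)

Section dot_product.
Context {R : realType} {n : nat}.
Implicit Types (x y z w : 'rV[R]_n) (c : R).

Lemma dotpC x y : dotp x y = dotp y x.
Proof. by apply: eq_bigr => i _; rewrite mulrC. Qed.

Lemma dotpDl x y z : dotp (x + y) z = dotp x z + dotp y z.
Proof. by rewrite -big_split; apply: eq_bigr => i _; rewrite mxE mulrDl. Qed.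

Lemma dotpNl x z : dotp (- x) z = - dotp x z.
Proof. by rewrite -sumrN; apply: eq_bigr => i _; rewrite mxE mulNr. Qed.

Lemma dotpZl c x z : dotp (c *: x) z = c * dotp x z.
Proof. by rewrite mulr_sumr; apply: eq_bigr => i _; rewrite mxE mulrA. Qed.

Lemma dotpDr x y z : dotp z (x + y) = dotp z x + dotp z y.
Proof. by rewrite !(dotpC z) dotpDl. Qed.

Lemma dotpNr x z : dotp z (- x) = - dotp z x.
Proof. by rewrite !(dotpC z) dotpNl. Qed.

Lemma dotpZr c x z : dotp z (c *: x) = c * dotp z x.
Proof. by rewrite !(dotpC z) dotpZl. Qed.

Lemma dotp_ge0 x : 0 <= dotp x x.
Proof. by apply: sumr_ge0 => i _; rewrite -expr2 sqr_ge0. Qed.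

Lemma sqr_coord_le_dotp x i : `|x 0 i| ^+ 2 <= dotp x x.
Proof.
rewrite /dotp (bigD1 i)//= real_normK ?num_real// expr2 lerDl.
by apply: sumr_ge0 => j _; rewrite -expr2 sqr_ge0.
Qed.

Lemma coord_le_enorm x i : `|x 0 i| <= enorm x.
Proof.
by rewrite -sqrtr_sqr ler_wsqrtr// -real_normK ?num_real// sqr_coord_le_dotp.
Qed.

Lemma norm_le_enorm x : `|x| <= enorm x.
Proof.
rewrite [leLHS](_ : _ = mx_norm x)// mx_normrE.
apply: bigmax_le; first exact: sqrtr_ge0.
by move=> [i j] _ /=; rewrite (ord1 i) coord_le_enorm.
Qed.

(** A sum of squares is at most the square of the sum of absolute values. This bounds the
    displacement of a characteristic coordinate by coordinate. *)
Lemma enorm_le_sum x : enorm x <= \sum_i `|x 0 i|.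
Proof.
have s0 : 0 <= \sum_i `|x 0 i| by apply: sumr_ge0.
rewrite -(ger0_norm s0) -sqrtr_sqr ler_wsqrtr// expr2 mulr_suml.
apply: ler_sum => i _; rewrite -expr2 -real_normK ?num_real// expr2.
by rewrite ler_wpM2l// (bigD1 i)//= lerDl sumr_ge0.
Qed.

Lemma compact_norm_le x (r : R) :
  compact [set y : 'rV[R]_n | `|x - y| <= r].
Proof.
apply: bounded_closed_compact.
  exists (`|x| + r); split; first exact: num_real.
  move=> M rM y /= xy.
  rewrite (le_trans _ (ltW rM))// -[y](subKr x) (le_trans (ler_normB _ _))//.
  by rewrite lerD2l.
exact: closed_closed_ball_.
Qed.

End dot_product.

(** * Calculus of directional derivatives *)

Section directional_derivatives.
Context {R : realType} {V : normedModType R}.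
Implicit Types (f : V -> R^o) (x v w : V) (U : set V).

Lemma is_derive_line f x w (s : R) :
  derivable f (x + s *: w) w ->
  is_derive s 1 (fun r : R => f (x + r *: w) : R^o) ('D_w f (x + s *: w)).
Proof.
have E : (fun h : R => h^-1 *: (((fun r : R => f (x + r *: w)) \o shift s) (h *: 1)
             - f (x + s *: w)))
       = (fun h : R => h^-1 *: ((f \o shift (x + s *: w)) (h *: w)
             - f (x + s *: w))).
  apply/funext => h /=; congr (_ *: (f _ - _)).
  by rewrite [h *: 1]mulr1 scalerDl addrCA.
by move=> df; apply: DeriveDef; rewrite /derivable /derive E.
Qed.

(** One-variable mean value theorem applied to [f (x + r *: w)] for [r] in [0, 1]. *)
Lemma MVT_line f x w :
  (forall s : R, 0 <= s <= 1 -> derivable f (x + s *: w) w) ->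
  exists2 s : R, 0 <= s <= 1 & f (x + w) - f x = 'D_w f (x + s *: w).
Proof.
move=> df.
have D (s : R) : s \in `[0, 1] ->
    is_derive s 1 (fun r : R => f (x + r *: w) : R^o) ('D_w f (x + s *: w)).
  by rewrite in_itv /= => /df; exact: is_derive_line.
pose phi (r : R) : R := f (x + r *: w).
pose dphi (s : R) : R := 'D_w f (x + s *: w).
have D1 (s : R) : s \in `]0, 1[%R -> is_derive s 1 phi (dphi s).
  by move=> /subset_itv_oo_cc; exact: D.
have C : {within `[0, 1], continuous phi}.
  by apply: derivable_within_continuous => s /D [].
have [s s01] := MVT_segment ler01 D1 C.
rewrite /phi /dphi scale1r scale0r addr0 subr0 mulr1 => ->.
by exists s => //; move: s01; rewrite in_itv.
Qed.

(** For nonzero [c], the quotient along [c *: v] at [h] is [c] times the quotient along [v] at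
    [h * c], and [h * c] tends to 0 through nonzero values. *)
Lemma is_deriveZdir f x v (c : R) :
  derivable f x v -> is_derive x (c *: v) f (c * 'D_v f x).
Proof.
move=> dfx; have [->|c0] := eqVneq c 0.
  rewrite scale0r mul0r; exact: is_derive0.
suff L : (fun h : R => h^-1 *: ((f \o shift x) (h *: (c *: v)) - f x)) @ 0^'
    --> (c * 'D_v f x : R^o).
  apply: DeriveDef; first by apply/cvg_ex; exists (c * 'D_v f x : R^o).
  exact: cvg_lim L.
have -> : (fun h : R => h^-1 *: ((f \o shift x) (h *: (c *: v)) - f x)) =
    (fun h : R => c *:
      ((fun h : R => h^-1 *: ((f \o shift x) (h *: v) - f x) : R^o) (h * c))).
  apply/funext => h /=; rewrite !scalerA invfM mulrCA mulfV// mulr1.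
  by [].
apply: cvgZr.
have dfx' : (fun h : R => h^-1 *: ((f \o shift x) (h *: v) - f x) : R^o) @ 0^'
    --> ('D_v f x : R^o).
  exact: dfx.
apply: cvg_comp dfx'.
move=> A; rewrite /dnbhs /within /= => [[e e0 Ae]].
exists (e / `|c|); first by rewrite /= divr_gt0// normr_gt0.
move=> h /=; rewrite sub0r normrN => he h0; apply: Ae; last by rewrite mulf_neq0.
by rewrite /= sub0r normrN normrM -ltr_pdivlMr// normr_gt0.
Qed.

(* Split the increment at [x + h v]; the second part is [h] times ['D_w f] at a
   nearby point, by the mean value theorem, and ['D_w f] is continuous. *)
Lemma is_deriveDdir U f x v w : open U -> Ck_open 1 U f -> U x ->
  is_derive x (v + w) f ('D_v f x + 'D_w f x).
Proof.
move=> oU [_ Cf] Ux.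
have [dv _] := Cf v; have [dw [cw _]] := Cf w.
suff L : (fun h : R => h^-1 *: ((f \o shift x) (h *: (v + w)) - f x)) @ 0^'
    --> ('D_v f x + 'D_w f x : R^o).
  apply: DeriveDef; first by apply/cvg_ex; exists ('D_v f x + 'D_w f x : R^o).
  exact: cvg_lim L.
have -> : (fun h : R => h^-1 *: ((f \o shift x) (h *: (v + w)) - f x)) =
   (fun h : R => (h^-1 *: ((f \o shift x) (h *: v) - f x) : R^o) +
      h^-1 *: (f (h *: v + x + h *: w) - f (h *: v + x) : R^o)).
  apply/funext => h /=; rewrite -scalerDr; congr (_ *: _).
  by rewrite [RHS]addrC subrKA scalerDr addrAC.
apply: cvgD; first exact: dv.
apply/cvgrPdist_lt => e e0.
have /cvgrPdist_lt /(_ e e0) cwx := cw x Ux.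
have Ux' : nbhs x U by exact: open_nbhs_nbhs.
have /nbhs_ballP [d d0 dU] : nbhs x (U `&` [set y | `|'D_w f x - 'D_w f y| < e]).
  by apply: filterI.
(* [K] exceeds the norm of [v + s *: w] for all [s] in [0, 1], so [|h| < d / K] keeps the whole
   segment in the ball of radius [d]. *)
pose K := `|v| + `|w| + 1.
have K0 : 0 < K by rewrite /K; have := normr_ge0 v; have := normr_ge0 w; lra.
exists (d / K); first by rewrite /= divr_gt0.
move=> h /=; rewrite sub0r normrN => hd h0.
have B (s : R) : 0 <= s <= 1 -> ball x d (h *: v + x + s *: (h *: w)).
  move=> /andP[s0 s1]; rewrite -ball_normE /=.
  have -> : x - (h *: v + x + s *: (h *: w)) = - (h *: (v + s *: w)).
    by rewrite -addrA addrCA opprD addNKr scalerDr !scalerA (mulrC s) opprD.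
  rewrite normrN normrZ; move: hd; rewrite ltr_pdivlMr//; apply: le_lt_trans.
  rewrite ler_wpM2l//; apply: (le_trans (ler_normD _ _)).
  rewrite normrZ (ger0_norm s0) /K.
  have : s * `|w| <= 1 * `|w| by rewrite ler_wpM2r.
  lra.
have [s s01 ->] := @MVT_line f (h *: v + x) (h *: w) (fun s s01 =>
  @ex_derive _ _ _ _ _ _ _ (is_deriveZdir h (dw _ (dU _ (B s s01)).1))).
have [Us cs] := dU _ (B s s01).
rewrite (@derive_val _ _ _ _ _ _ _ (is_deriveZdir h (dw _ Us))).
by rewrite [_ *: _]mulrA mulVf// mul1r.
Qed.

End directional_derivatives.

(** * Second-order remainder bounds and the tangent inequality for convex functions *)

Section second_order.
Context {R : realType} {V : normedModType R}.
Implicit Types (f : V -> R^o) (x v w : V) (U K : set V).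

Lemma Ck_openS k U f : Ck_open k.+1 U f -> Ck_open k U f.
Proof.
elim: k f => [|k IH] f [cf Cf]; first by split.
split=> // v; have [dv Cv] := Cf v; split=> //; exact: IH.
Qed.

Lemma derive_comb U f x n (e : 'I_n -> V) (c : 'I_n -> R) :
  open U -> Ck_open 1 U f -> U x ->
  'D_(\sum_i c i *: e i) f x = \sum_i c i * 'D_(e i) f x.
Proof.
move=> oU Cf Ux.
elim/big_rec2 : _ => [|i y w _ <-]; first exact: derive0.
rewrite (@derive_val _ _ _ _ _ _ _ (is_deriveDdir (c i *: e i) w oU Cf Ux)).
congr (_ + _); apply: derive_val; apply: is_deriveZdir.
by case: Cf => _ /(_ (e i))[+ _]; apply.
Qed.

(** Linearity in the direction is used twice: first for the outer derivative of ['D_w f], then for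
    ['D_w f] itself. *)
Lemma derive2_comb U f x n (e : 'I_n -> V) (c : 'I_n -> R) :
  open U -> Ck_open 2 U f -> U x ->
  let w := \sum_i c i *: e i in
  'D_w ('D_w f) x =
  \sum_j \sum_i c j * (c i * 'D_(e j) ('D_(e i) f) x).
Proof.
move=> oU Cf Ux w.
have Cw : Ck_open 1 U ('D_w f) by case: Cf => _ /(_ w) [].
rewrite {1}/w (derive_comb e c oU Cw Ux); apply: eq_bigr => j _.
rewrite -mulr_sumr; congr (_ * _).
have dd i : derivable ('D_(e i) f : V -> R^o) x (e j).
  by case: Cf => _ /(_ (e i)) [_ [_ /(_ (e j)) [+ _]]]; apply.
(* To be differentiated, the expansion of ['D_w f] must hold near [x] and not only at [x]; openness
   of [U] provides this. *)
transitivity ('D_(e j) (\sum_i (c i \*: ('D_(e i) f : V -> R^o))) x).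
  apply: near_eq_derive.
  have Ux' : nbhs x U by exact: open_nbhs_nbhs.
  apply: filterS Ux' => y Uy.
  rewrite (derive_comb e c oU (Ck_openS Cf) Uy).
  by rewrite fct_sumE.
rewrite derive_sum => [|i]; last by apply: derivableZ.
by apply: eq_bigr => i _; rewrite deriveZ.
Qed.

Lemma compact_ub (I : finType) (K : set V) (F : I -> V -> R^o) :
  compact K -> (forall i x, K x -> {for x, continuous (F i)}) ->
  exists2 B, 0 < B & forall i x, K x -> `|F i x| <= B.
Proof.
move=> cK cF.
have H i : exists b : R, forall x, K x -> `|F i x| <= b.
  have : {within K, continuous (F i)}.
    by apply: continuous_in_subspaceT => x; rewrite inE => /(cF i).
  move=> /continuous_compact/(_ cK)/compact_bounded[M [Mr HM]].
  exists (M + 1) => x Kx; apply: HM; first by rewrite ltrDl.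
  by exists x.
have [b Hb] := choice H.
(* The sum dominates each bound; the 1 keeps it positive when [I] is empty. *)
exists (1 + \sum_i `|b i|); first by rewrite ltr_pwDl// sumr_ge0.
move=> i x Kx; apply: (le_trans (Hb i x Kx)).
rewrite (bigD1 i)//= addrCA; apply: (le_trans (ler_norm _)).
by rewrite lerDl addr_ge0// sumr_ge0.
Qed.

(** Two mean value theorems, for [f] and then for ['D_w f] on the shortened segment [s *: w]. The
    second brings out a factor [s <= 1], which is dropped. *)
Lemma MVT_line2 f x w :
  (forall s : R, 0 <= s <= 1 -> derivable f (x + s *: w) w) ->
  (forall s : R, 0 <= s <= 1 -> derivable ('D_w f : V -> R^o) (x + s *: w) w) ->
  exists2 s : R, 0 <= s <= 1 &
    `|f (x + w) - f x - 'D_w f x| <= `|'D_w ('D_w f) (x + s *: w)|.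
Proof.
move=> d1 d2.
have [s /andP[s0 s1] ->] := MVT_line d1.
have d2' (r : R) : 0 <= r <= 1 ->
    derivable ('D_w f : V -> R^o) (x + r *: (s *: w)) w.
  move=> /andP[r0 r1]; rewrite scalerA; apply: d2.
  by rewrite mulr_ge0//= mulr_ile1.
have [r /andP[r0 r1] ->] := @MVT_line _ _ ('D_w f) x (s *: w)
  (fun r r01 => @ex_derive _ _ _ _ _ _ _ (is_deriveZdir s (d2' r r01))).
have r01 : 0 <= r <= 1 by rewrite r0.
rewrite (@derive_val _ _ _ _ _ _ _ (is_deriveZdir s (d2' r r01))) scalerA.
exists (r * s); first by rewrite mulr_ge0//= mulr_ile1.
by rewrite normrM (ger0_norm s0) ler_piMl.
Qed.

(** The second derivatives along the [e i] are bounded on [K]. The family [e] need not span [V]: in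
    time-space it consists of the spatial directions only, which makes the bound uniform in time. *)
Lemma quadratic_remainder U K f n (e : 'I_n -> V) :
  open U -> Ck_open 2 U f -> compact K -> K `<=` U ->
  exists2 B, 0 < B & forall x (w : 'rV[R]_n),
    (forall s : R, 0 <= s <= 1 -> K (x + s *: \sum_i w 0 i *: e i)) ->
    `|f (x + \sum_i w 0 i *: e i) - f x - \sum_i w 0 i * 'D_(e i) f x|
      <= B * dotp w w.
Proof.
move=> oU Cf cK KU.
have [|B B0 HB] := @compact_ub ('I_n * 'I_n)%type K
    (fun ij => 'D_(e ij.1) ('D_(e ij.2) f)) cK.
  move=> [i j] x /KU Ux /=.
  by case: Cf => _ /(_ (e j)) [_ [_ /(_ (e i))[_ [+ _]]]]; apply.
(* There are [n * n] second-order terms, each at most [B * dotp w w]; adding 1 keeps the constant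
   positive when [n = 0]. *)
exists (B * (n * n)%:R + 1) => [|x w Kw].
  by rewrite ltr_wpDl// mulr_ge0// ltW.
have KU0 (s : R) : 0 <= s <= 1 -> U (x + s *: \sum_i w 0 i *: e i).
  by move=> /Kw/KU.
have Ux : U x by move: (KU0 0); rewrite scale0r addr0 lexx ler01; apply.
rewrite -(derive_comb e (fun i => w 0 i) oU (Ck_openS Cf) Ux).
set W := \sum_i _ in Kw KU0 *.
have [s s01|s s01|s s01] := @MVT_line2 f x W.
- by case: Cf => _ /(_ W) [+ _]; apply; exact: KU0.
- by case: Cf => _ /(_ W) [_ [_ /(_ W)[+ _]]]; apply; exact: KU0.
move=> /le_trans; apply.
rewrite (derive2_comb e (fun i => w 0 i) oU Cf (KU0 _ s01)).
apply: (@le_trans _ _ (\sum_(j < n) \sum_(i < n) B * dotp w w)).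
  apply: (le_trans (ler_norm_sum _ _ _)); apply: ler_sum => j _.
  apply: (le_trans (ler_norm_sum _ _ _)); apply: ler_sum => i _.
  rewrite !normrM mulrA mulrC ler_pM//; last first.
    have := sqr_coord_le_dotp w i; have := sqr_coord_le_dotp w j;
    have := normr_ge0 (w 0 i); have := normr_ge0 (w 0 j).
    set a := `|w 0 i|; set b := `|w 0 j|; nra.
  exact: (HB (j, i) _ (Kw _ s01)).
rewrite !sumr_const !card_ord -mulrnA mulrDl mul1r.
by rewrite -mulrnAl mulr_natr lerDl dotp_ge0.
Qed.

(** By convexity on the segment from [x] to [x + w], each quotient with [0 < h <= 1] is at most
    [f (x + w) - f x]; then [h] tends to 0 from the right. *)
Lemma convex_tangent f x w : convex_function setT f -> derivable f x w ->
  'D_w f x <= f (x + w) - f x.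
Proof.
move=> cf df.
have df' : (fun h : R => h^-1 *: ((f \o shift x) (h *: w) - f x) : R^o) @ 0^'+
   --> ('D_w f x : R^o).
  by apply: cvg_dnbhs_at_right; exact: df.
rewrite -(cvg_lim _ df')//; apply: limr_le.
  by apply/cvg_ex; eexists; exact: df'.
near=> h.
have h0 : 0 < h by near: h; exact: nbhs_right_gt.
have h1 : h <= 1 by near: h; exact: nbhs_right_le.
rewrite /= [_ *: _]mulrC ler_pdivrMr//.
have h01 : Itv.spec (@Itv.num_sem R) (Itv.Real `[0%Z, 1%Z]) h.
  by rewrite /= /Itv.num_sem /= num_real in_itv /= (ltW h0) h1.
have := cf (Itv.mk h01) (x + w) x; rewrite !inE => /(_ I I).
rewrite /conv /= /unstable.onem.
have -> : h *: (x + w) + (1 - h) *: x = h *: w + x.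
  by rewrite scalerDr scalerBl scale1r addrC addrA subrK addrC.
move=> cfh.
have {}cfh : f (h *: w + x) <= h * f (x + w) + (1 - h) * f x by exact: cfh.
lra.
Unshelve. all: by end_near. Qed.

End second_order.

(** * Oriented integrals of real functions *)

Section oriented_integrals.
Context {R : realType}.
Implicit Types (f g : R -> R) (a b c t : R).
Let mu := @lebesgue_measure R.

Lemma integrable_segment f a b c d : c <= a -> b <= d ->
  mu.-integrable `[c, d] (EFin \o f) -> mu.-integrable `[a, b] (EFin \o f).
Proof.
move=> ca bd; apply: integrableS => //.
by apply: subset_itv; rewrite bnd_simp.
Qed.

Lemma oint0 f a : oint a a f = 0.
Proof. by rewrite /oint lexx set_itv1 Rintegral_set1. Qed.

(** Valid for either order of [a] and [b], so that a curve written from [t0] can be rewritten from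
    time 0 in both directions. *)
Lemma oint_from0 T f a b : mu.-integrable `[0, T] (EFin \o f) ->
  0 <= a <= T -> 0 <= b <= T -> oint a b f = oint 0 b f - oint 0 a f.
Proof.
move=> fi.
have S s t : 0 <= s -> s <= t -> t <= T ->
    \int[mu]_(r in `[s, t]) f r = oint 0 t f - oint 0 s f.
  move=> s0 st tT; rewrite /oint s0 (le_trans s0 st).
  have fit := integrable_segment (lexx 0) tT fi.
  rewrite (Rintegral_itvB fit) ?bnd_simp// Rintegral_itv_obnd_cbnd//.
  by apply: integrableS fit => //; apply: subset_itv; rewrite bnd_simp.
move=> /andP[a0 aT] /andP[b0 bT]; rewrite {1}/oint.
by case: leP => [ab|/ltW ba]; rewrite S// opprB.
Qed.

(** The endpoints are null sets. The comparison is asked on the open interval only because (A2)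
    gives signs on (0, T). *)
Lemma le_oint f g a b : a <= b ->
  mu.-integrable `[a, b] (EFin \o f) -> mu.-integrable `[a, b] (EFin \o g) ->
  (forall s, a < s < b -> f s <= g s) -> oint a b f <= oint a b g.
Proof.
move=> ab fi gi fg.
have S h : mu.-integrable `[a, b] (EFin \o h) ->
    oint a b h = \int[mu]_(r in `]a, b[) h r.
  move=> hi; rewrite /oint ab -Rintegral_itv_obnd_cbnd.
    rewrite -Rintegral_itv_bndo_bndc//.
    by apply: integrableS hi => //; apply: subset_itv; rewrite bnd_simp.
  by apply: integrableS hi => //; apply: subset_itv; rewrite bnd_simp.
rewrite !S//; apply: le_Rintegral => //.
- by apply: integrableS fi => //; apply: subset_itv; rewrite bnd_simp.
- by apply: integrableS gi => //; apply: subset_itv; rewrite bnd_simp.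
Qed.

Lemma oint_cst c a b : a <= b -> oint a b (fun=> c) = c * (b - a).
Proof.
move=> ab; rewrite /oint ab Rintegral_cst//= lebesgue_measure_itv /= lte_fin.
by case: ltgtP ab => // -> _ /=; rewrite subrr mulr0.
Qed.

Lemma integrable_cst c a b : mu.-integrable `[a, b] (EFin \o (fun=> c)).
Proof.
apply: continuous_compact_integrable; first exact: segment_compact.
by apply: continuous_subspaceT => x; exact: cvg_cst.
Qed.

Lemma ointB f g t : 0 <= t ->
  mu.-integrable `[0, t] (EFin \o f) -> mu.-integrable `[0, t] (EFin \o g) ->
  oint 0 t (fun s => f s - g s) = oint 0 t f - oint 0 t g.
Proof. by move=> t0 fi gi; rewrite /oint t0 RintegralB. Qed.

Lemma integrable_sub f g t :
  mu.-integrable `[0, t] (EFin \o f) -> mu.-integrable `[0, t] (EFin \o g) ->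
  mu.-integrable `[0, t] (EFin \o (fun s => f s - g s)).
Proof. by move=> fi gi; apply: (integrableB _ fi gi). Qed.

Lemma integrable_comb n (f : 'I_n -> R -> R) (c : 'I_n -> R) t :
  (forall i, mu.-integrable `[0, t] (EFin \o f i)) ->
  mu.-integrable `[0, t] (EFin \o (fun s => \sum_i c i * f i s)).
Proof.
move=> fi.
rewrite (_ : _ \o _ = (fun s => \sum_i (c i)%:E * (f i s)%:E)%E).
  by apply: integrable_sum => // i _; apply: integrableZl => //; exact: fi.
by apply/funext => s /=; rewrite sumEFin.
Qed.

Lemma oint_comb n (f : 'I_n -> R -> R) (c : 'I_n -> R) t : 0 <= t ->
  (forall i, mu.-integrable `[0, t] (EFin \o f i)) ->
  oint 0 t (fun s => \sum_i c i * f i s) = \sum_i c i * oint 0 t (f i).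
Proof.
move=> t0 fi.
under [RHS]eq_bigr do rewrite /oint t0 -RintegralZl//.
rewrite /oint t0.
elim: n f c fi => [|n IH] f c fi.
  under eq_Rintegral do rewrite big_ord0.
  by rewrite big_ord0 Rintegral_cst// mul0r.
under eq_Rintegral do rewrite big_ord_recl.
rewrite big_ord_recl RintegralD//; last 2 first.
- by have := @integrable_comb 1 (fun=> f ord0) (fun=> c ord0) t (fun=> fi ord0);
    congr integrable; apply/funext => s /=; rewrite big_ord1.
- exact: (@integrable_comb n (fun i => f (lift ord0 i)) (fun i => c (lift ord0 i))).
congr (_ + _); exact: (IH (fun i => f (lift ord0 i)) (fun i => c (lift ord0 i))).
Qed.

Lemma oint_lipschitz T C f s t : mu.-integrable `[0, T] (EFin \o f) ->
  (forall r, 0 <= r <= T -> `|f r| <= C) -> 0 <= s <= t -> t <= T ->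
  `|oint 0 t f - oint 0 s f| <= C * (t - s).
Proof.
move=> fi fC /andP[s0 st] tT.
rewrite -(oint_from0 fi); [|lra|lra].
rewrite /oint st.
have fi' := integrable_segment s0 tT fi.
apply: (le_trans (le_normr_Rintegral _ fi')) => //.
rewrite -oint_cst// /oint st; apply: le_Rintegral => //.
- exact: integrable_norm fi'.
- exact: integrable_cst.
- by move=> r /=; rewrite in_itv /= => ?; apply: fC; lra.
Qed.

End oriented_integrals.

(** * Bregman excess, first for a C^2 function of space alone *)

Definition bregman {R : realType} {n : nat} (f : 'rV[R]_n -> R)
    (p q : 'rV[R]_n) : R :=
  f q - f p - dotp (q - p) (grad f p).

Section space_C2.
Context {R : realType} {n : nat}.
Variable f : 'rV[R]_n -> R.
Hypothesis f_C2 : Ck_on 2 [set: 'rV[R]_n] f.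

Lemma Ck_on_setT : Ck_open 2 setT f.
Proof.
have [U [g [_ TU Cg fg]]] := f_C2.
have <- : g = f by apply/funext => x; rewrite fg.
by have <- : U = setT by apply/seteqP; split=> // x _; exact: TU.
Qed.

Lemma derive_grad x v : 'D_v (f : 'rV[R]_n -> R^o) x = dotp v (grad f x).
Proof.
rewrite {1}(row_sum_delta v) (derive_comb _ _ openT (Ck_openS Ck_on_setT) I).
by apply: eq_bigr => i _; rewrite mxE.
Qed.

Lemma convex_bregman_ge0 x y : convex_function setT f -> 0 <= bregman f x y.
Proof.
move=> cf; rewrite /bregman -derive_grad subr_ge0.
rewrite -{2}[y](subrKC x); apply: convex_tangent => //.
by have [_ /(_ (y - x))[+ _]] := Ck_on_setT; apply.
Qed.

(** This is [quadratic_remainder] for the coordinate directions on a closed sup-norm ball, which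
    contains the segments from its centre. *)
Lemma bregman_quadratic x r :
  exists2 B, 0 < B & forall y, `|y - x| <= r ->
    `|bregman f x y| <= B * dotp (y - x) (y - x).
Proof.
have [B B0 HB] := quadratic_remainder (fun i : 'I_n => delta_mx 0 i)
  openT Ck_on_setT (@compact_norm_le R n x r) (@subsetT _ _).
exists B => // y yx; have := HB x (y - x).
rewrite -row_sum_delta /bregman subrKC.
rewrite (_ : \sum_i _ = dotp (y - x) (grad f x)); last first.
  by apply: eq_bigr => i _; rewrite !mxE.
apply=> s /andP[s0 s1] /=; rewrite opprD addNKr normrN normrZ (ger0_norm s0).
by apply: le_trans yx; rewrite ler_piMl.
Qed.

End space_C2.

(** * Regularity and Bregman excess of the time-dependent Hamiltonian *)

Section time_dependent_C2.
Context {R : realType} {n : nat}.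
Variables (T : R) (H : R -> 'rV[R]_n -> R).
Hypothesis H_C2 : Ck_on 2 [set z : (R^o * 'rV[R]_n)%type | 0 <= z.1 <= T]
  (fun z => H z.1 z.2).
Implicit Types (t : R) (p q v : 'rV[R]_n).
Let mu := @lebesgue_measure R.

(** Embeds a spatial direction in time-space, so that derivatives of a slice at fixed time become
    directional derivatives of a function of both variables. *)
Let space v : (R^o * 'rV[R]_n)%type := (0, v).

Let space_sum v : space v = \sum_i v 0 i *: space (delta_mx 0 i).
Proof.
rewrite {1}[v]row_sum_delta (big_morph space (id1 := 0) (op1 := +%R))//; last first.
  by move=> x y; rewrite /space; congr pair; rewrite addr0.
by apply: eq_bigr => i _; rewrite /space; congr pair; rewrite [RHS]mulr0.
Qed.

(** For each [t] in [0, T], endpoints included, [H t] and the slice of [g] agree as functions of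
    [p], hence so do their spatial gradients. *)
Lemma C2_extension : exists U g, [/\ open U,
    [set z : (R^o * 'rV[R]_n)%type | 0 <= z.1 <= T] `<=` U,
    Ck_open 2 U g &
    forall t, 0 <= t <= T -> H t = fun p => g (t, p)].
Proof.
have [U [g [oU TU Cg Hg]]] := H_C2; exists U, g; split=> // t t0T.
by apply/funext => p; rewrite (Hg (t, p)).
Qed.

Let slice_quotient (g : R^o * 'rV[R]_n -> R^o) t p v :
  (fun h : R => h^-1 *: (((fun p => g (t, p)) \o shift p) (h *: v) - g (t, p)))
  = (fun h : R => h^-1 *: ((g \o shift (t, p)) (h *: space v) - g (t, p))).
Proof.
apply/funext => h /=; congr (_ *: (g _ - _)).
by congr pair; rewrite /= [_ *: 0]mulr0 add0r.
Qed.

Let derive_slice (g : R^o * 'rV[R]_n -> R^o) t p v :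
  'D_v (fun p => g (t, p)) p = 'D_(space v) g (t, p).
Proof. by rewrite /derive slice_quotient. Qed.

Let derivable_slice (g : R^o * 'rV[R]_n -> R^o) t p v :
  derivable g (t, p) (space v) -> derivable (fun p => g (t, p)) p v.
Proof. by rewrite /derivable slice_quotient. Qed.

Lemma H_derivable t p v : 0 <= t <= T -> derivable (H t : 'rV[R]_n -> R^o) p v.
Proof.
have [U [g [_ TU [_ Cg] Hg]]] := C2_extension => t0T.
rewrite Hg//; apply: derivable_slice; have [+ _] := Cg (space v); apply.
exact: TU.
Qed.

Lemma H_derive_grad t p v : 0 <= t <= T ->
  'D_v (H t : 'rV[R]_n -> R^o) p = dotp v (grad (H t) p).
Proof.
have [U [g [oU TU Cg Hg]]] := C2_extension => t0T.
rewrite Hg// derive_slice space_sum (derive_comb _ _ oU (Ck_openS Cg));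
  last exact: TU.
by apply: eq_bigr => i _; rewrite mxE derive_slice.
Qed.

Let slice_continuous U (g : R^o * 'rV[R]_n -> R^o) (f : R -> R) p :
  [set z : (R^o * 'rV[R]_n)%type | 0 <= z.1 <= T] `<=` U ->
  (forall z, U z -> {for z, continuous g}) ->
  (forall t, 0 <= t <= T -> f t = g (t, p)) ->
  {within `[0, T], continuous f}.
Proof.
move=> TU cg fg.
apply: (@subspace_eq_continuous _ _ _ (fun t => g (t, p))).
  by move=> t; rewrite inE /= in_itv /= => /fg.
apply: continuous_in_subspaceT => t; rewrite inE /= in_itv /= => t0T.
apply: (@continuous_comp _ _ _ (fun t : R => (t, p) : R^o * 'rV[R]_n) g).
  by apply: (@cvg_pair _ _ _ _ (nbhs (t : R^o)) (nbhs p)); [exact: cvg_id|exact: cvg_cst].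
exact: (cg (t, p) (TU (t, p) t0T)).
Qed.

Lemma H_time_continuous p : {within `[0, T], continuous (fun t => H t p)}.
Proof.
have [U [g [oU TU [cg _] Hg]]] := C2_extension.
by apply: (slice_continuous (p := p) TU cg) => t /Hg ->.
Qed.

Lemma grad_time_continuous p i :
  {within `[0, T], continuous (fun t => grad (H t) p 0 i)}.
Proof.
have [U [g [oU TU [_ Cg] Hg]]] := C2_extension.
have [_ [cg _]] := Cg (space (delta_mx 0 i)).
by apply: (slice_continuous (p := p) TU cg) => t /Hg ->; rewrite mxE derive_slice.
Qed.

Lemma H_time_integrable p : mu.-integrable `[0, T] (EFin \o (fun t => H t p)).
Proof.
apply: continuous_compact_integrable; first exact: segment_compact.
exact: H_time_continuous.
Qed.

Lemma grad_time_integrable p i :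
  mu.-integrable `[0, T] (EFin \o (fun t => grad (H t) p 0 i)).
Proof.
apply: continuous_compact_integrable; first exact: segment_compact.
exact: grad_time_continuous.
Qed.

Lemma grad_time_bounded p :
  exists2 B, 0 < B & forall i t, 0 <= t <= T -> `|grad (H t) p 0 i| <= B.
Proof.
have [U [g [oU TU [_ Cg] Hg]]] := C2_extension.
have cK := compact_setX (@segment_compact R 0 T) (@compact_set1 _ p).
have [|B B0 HB] := @compact_ub R (R^o * 'rV[R]_n)%type 'I_n _
  (fun i => 'D_(space (delta_mx 0 i)) g) cK.
  move=> i [t q] [/=]; rewrite in_itv /= => tT _.
  by have [_ [+ _]] := Cg (space (delta_mx 0 i)); apply; exact: TU.
exists B => // i t tT; rewrite Hg// mxE derive_slice; apply: HB.
by split=> //=; rewrite in_itv.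
Qed.

(** One constant serves all times because the product of [0, T] with a closed ball is compact. *)
Lemma H_bregman_quadratic p r : exists2 B, 0 < B & forall t q, 0 <= t <= T ->
  `|q - p| <= r -> `|bregman (H t) p q| <= B * dotp (q - p) (q - p).
Proof.
have [U [g [oU TU Cg Hg]]] := C2_extension.
have cK := compact_setX (@segment_compact R 0 T) (@compact_norm_le R n p r).
have [|B B0 HB] := quadratic_remainder (fun i : 'I_n => space (delta_mx 0 i))
  oU Cg cK.
  by move=> [t q] [/=]; rewrite in_itv /= => tT _; exact: TU.
exists B => // t q tT qp; have := HB (t, p) (q - p).
rewrite -space_sum /bregman; under eq_bigr do rewrite -derive_slice.
have -> : (t, p) + space (q - p) = (t, q).
  by rewrite /space; congr pair; rewrite /= ?addr0// subrKC.
have HE y : H t y = g (t, y) by rewrite Hg.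
rewrite !HE (_ : \sum_i _ = dotp (q - p) (grad (H t) p)); last first.
  by apply: eq_bigr => i _; rewrite !mxE Hg.
apply=> s /andP[s0 s1]; split => /=.
  by rewrite [s *: 0]mulr0 addr0 in_itv.
rewrite opprD addNKr normrN normrZ (ger0_norm s0).
by apply: le_trans qp; rewrite ler_piMl.
Qed.

Lemma H_convex_bregman_ge0 t p q : 0 <= t <= T -> convex_function setT (H t) ->
  0 <= bregman (H t) p q.
Proof.
move=> tT cH; rewrite /bregman -H_derive_grad// subr_ge0.
by rewrite -{2}[q](subrKC p); apply: convex_tangent => //; exact: H_derivable.
Qed.

Lemma H_concave_bregman_le0 t p q : 0 <= t <= T ->
  convex_function setT (fun p => - H t p) -> bregman (H t) p q <= 0.
Proof.
move=> tT cH; rewrite /bregman -H_derive_grad//.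
have dH : derivable (H t : 'rV[R]_n -> R^o) p (q - p) by exact: H_derivable.
have := convex_tangent (f := fun p => - H t p : R^o) cH (derivableN dH).
rewrite (deriveN dH) subrKC; lra.
Qed.

Lemma bregman_time_integrable p q :
  mu.-integrable `[0, T] (EFin \o (fun t => bregman (H t) p q)).
Proof.
rewrite /bregman; apply: integrable_sub.
  by apply: integrable_sub; exact: H_time_integrable.
apply: (integrable_comb (fun i => (q - p) 0 i)) => i; exact: grad_time_integrable.
Qed.

(** The linear part of the excess integrates to [q - p] paired with the integral of the gradient,
    which for [p = grad sigma y] is the displacement of the characteristic from [y]. *)
Lemma oint_bregman t p q : 0 <= t <= T ->
  oint 0 t (fun s => bregman (H s) p q) =
  oint 0 t (fun s => H s q) - oint 0 t (fun s => H s p) -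
  dotp (q - p) (ointv 0 t (fun s => grad (H s) p)).
Proof.
move=> /andP[t0 tT].
have S f : mu.-integrable `[0, T] (EFin \o f) -> mu.-integrable `[0, t] (EFin \o f).
  exact: integrable_segment.
rewrite /bregman ointB//; last 2 first.
- by apply: S; apply: integrable_sub; exact: H_time_integrable.
- by apply: integrable_comb => i; apply: S; exact: grad_time_integrable.
rewrite ointB//; [|by apply: S; exact: H_time_integrable..].
rewrite oint_comb// => [|i]; last by apply: S; exact: grad_time_integrable.
by congr (_ - _); apply: eq_bigr => i _; rewrite [in RHS]/ointv [in RHS]mxE.
Qed.

End time_dependent_C2.

(** The time sought is the supremum of the times in (0, t0] where [P] holds. *)
Lemma last_time {R : realType} (P : R -> Prop) (d t0 : R) :
  0 < d -> 0 < t0 ->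
  (forall t, 0 < t < d -> t <= t0 -> P t) ->
  (forall s t, 0 < s < t -> t <= t0 -> P t -> P s) ->
  (forall t, 0 < t <= t0 -> (forall s, 0 < s < t -> P s) -> P t) ->
  ~ P t0 ->
  exists t, [/\ 0 < t < t0, P t & forall s, t < s <= t0 -> ~ P s].
Proof.
move=> d0 t00 Pd Pdown Pclosed nP.
pose S := [set t | 0 < t <= t0 /\ P t].
(* Halving puts [m] strictly below [d]; it shows that the set is nonempty and its supremum
   positive. *)
pose m := Num.min d t0 / 2.
have m0 : 0 < m by rewrite divr_gt0// lt_min d0.
have md : Num.min d t0 <= d by rewrite ge_min lexx.
have mt : Num.min d t0 <= t0 by rewrite ge_min lexx orbT.
have mE : m * 2 = Num.min d t0 by rewrite /m divfK.
have Sm : S m by split; [|apply: Pd]; lra.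
have supS : has_sup S.
  by split; [exists m|exists t0 => t [/andP[]]].
have m_le : m <= sup S by exact: ub_le_sup (supS.2) _ Sm.
have le_t0 : sup S <= t0 by apply: ge_sup; [exists m|move=> t [/andP[]]].
have PS : P (sup S).
  apply: Pclosed; first lra.
  (* Any [s] below the supremum lies below some time where [P] holds, hence inherits [P] by downward
     propagation. *)
  move=> s /andP[s0 sS].
  have sS' : 0 < sup S - s by lra.
  have [t [/andP[t0' tt0] Pt] st] := sup_adherent sS' supS.
  by apply: (Pdown s t) => //; lra.
exists (sup S); split => //.
- rewrite (lt_le_trans m0 m_le)/= lt_neqAle le_t0 andbT.
  by apply/eqP => E; apply: nP; rewrite -E.
- move=> s /andP[Ss st0] Ps; suff : s <= sup S by lra.
  by apply: ub_le_sup (supS.2) _ _; split => //; lra.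
Qed.

(** * The times at which a characteristic is of type (I) *)

Section type_I_times.
Context {R : realType} {n : nat}.
Variables (T : R) (H : R -> 'rV[R]_n -> R) (sigma : 'rV[R]_n -> R).
Hypothesis T_gt0 : 0 < T.
Hypothesis sigma_convex : convex_function setT sigma.
Hypothesis A1 : condA1 H sigma T.
Hypothesis A2 : condA2 H T.
Hypothesis H_C2 : Ck_on 2 [set z : (R^o * 'rV[R]_n)%type | 0 <= z.1 <= T]
  (fun z => H z.1 z.2).
Hypothesis sigma_C2 : Ck_on 2 [set: 'rV[R]_n] sigma.
Variable y : 'rV[R]_n.
Implicit Types (t c : R) (p q : 'rV[R]_n).

Let p0 := grad sigma y.

(** The sign may depend on [p] and [q], but not on the time. *)
Lemma bregman_sign p q :
  (forall t, 0 < t < T -> 0 <= bregman (H t) p q) \/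
  (forall t, 0 < t < T -> bregman (H t) p q <= 0).
Proof.
have w t : 0 < t < T -> 0 <= t <= T by lra.
case: A2 => [[cH|cH]|[g [h [k [HE gs]]]]].
- by left=> t tT; apply: (H_convex_bregman_ge0 H_C2); [exact: w|exact: cH].
- by right=> t tT; apply: (H_concave_bregman_le0 H_C2); [exact: w|exact: cH].
(* Each [H t] is a nonnegative multiple of one [H s], up to a constant. *)
have [s [sT Hs]] : exists s, 0 < s < T /\ forall t, 0 < t < T ->
    exists2 c, 0 <= c & exists b, forall p, H t p = c * H s p + b.
  (* The reference time is one where [g] is nonzero, and the ratio [g t / g s] is nonnegative as [g]
     keeps its sign. If [g] vanishes on (0, T), any time will do, with factor 0. *)
  have [[s [sT gs0]]|ng] := pselect (exists s, 0 < s < T /\ g s != 0).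
    exists s; split=> // t tT; exists (g t / g s).
      case: gs => gs; first by rewrite divr_ge0// gs.
      by rewrite -[_ / _]opprK -mulNr -mulrN -invrN divr_ge0// oppr_ge0 gs.
    exists (k t - g t / g s * k s) => p'; rewrite !HE ?w//.
    by field.
  exists (T / 2); split; first by have := T_gt0; lra.
  move=> t tT; exists 0 => //; exists (k t) => p'; rewrite HE ?w// mul0r.
  suff -> : g t = 0 by rewrite mul0r.
  by apply: contrapT => /eqP gt0; apply: ng; exists t.
have E t : 0 < t < T -> exists2 c, 0 <= c & bregman (H t) p q = c * bregman (H s) p q.
  move=> /Hs[c c0 [b Hb]]; exists c => //.
  have HtE : H t = (c \*: (H s : 'rV[R]_n -> R^o)) + cst b.
    by apply/funext => p'; rewrite Hb.
  have G : grad (H t) p = c *: grad (H s) p.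
    apply/rowP => i; rewrite !mxE HtE.
    have dH : derivable (H s : 'rV[R]_n -> R^o) p (delta_mx 0 i).
      by apply: (H_derivable H_C2); exact: w.
    rewrite deriveD; [|exact: derivableZ|exact: derivable_cst].
    by rewrite derive_cst addr0 deriveZ.
  by rewrite /bregman G dotpZr !Hb; ring.
have [s0|s0] := leP 0 (bregman (H s) p q); [left|right] => t /E[c c0 ->].
  exact: mulr_ge0.
by rewrite mulr_ge0_le0// ltW.
Qed.

Lemma conjugate_lb z q : ((dotp z q - sigma z)%:E <= conjugate sigma q)%E.
Proof. by apply: ereal_sup_ubound; exists z. Qed.

(** Equality case of the Fenchel-Young inequality: the tangent inequality at [y] says that [y]
    attains the supremum. *)
Lemma conjugate_grad : conjugate sigma p0 = (dotp y p0 - sigma y)%:E.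
Proof.
apply/eqP; rewrite eq_le conjugate_lb andbT.
apply: ge_ereal_sup => _ [z _ <-]; rewrite lee_fin.
have := convex_bregman_ge0 sigma_C2 y z sigma_convex.
rewrite /bregman -/p0 dotpDl dotpNl; lra.
Qed.

(* For [c = conjugate sigma q] this is the [D(q)] of the header. *)
Definition gap q c := c - dotp y q + sigma y.

Definition excess t q := oint 0 t (fun s => bregman (H s) p0 q).

Lemma gap_ge0 q c : conjugate sigma q = c%:E -> 0 <= gap q c.
Proof. by move=> qc; have := conjugate_lb y q; rewrite qc lee_fin /gap; lra. Qed.

(** Quantifying over finite values [c] of the conjugate covers the value +oo too: there the Hopf
    function at [q] is -oo and both sides hold. The value -oo is ruled out by [conjugate_lb]. *)
Lemma hopf_leP t q : 0 <= t <= T ->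
  (hopf_fun H sigma t (char_curve H sigma y t) q <=
   hopf_fun H sigma t (char_curve H sigma y t) p0)%E <->
  (forall c, conjugate sigma q = c%:E -> 0 <= gap q c + excess t q).
Proof.
move=> tT.
have E := oint_bregman H_C2 p0 q tT.
rewrite /hopf_fun conjugate_grad /excess E /gap /char_curve -/p0.
set x := ointv _ _ _.
rewrite !dotpDl dotpNl (dotpC q x) (dotpC p0 x).
have := conjugate_lb y q.
case: (conjugate sigma q) => [c||] //= _.
  rewrite lee_fin; split=> [h _ [<-]|/(_ _ erefl)]; lra.
by split=> // _; rewrite leNye.
Qed.

Lemma type_IP t : 0 <= t <= T ->
  type_I H sigma y t (char_curve H sigma y t) <->
  (forall q c, conjugate sigma q = c%:E -> 0 <= gap q c + excess t q).
Proof.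
move=> tT; split=> [h q|h q]; first exact/hopf_leP.
by apply/hopf_leP => // c; exact: h.
Qed.

(** Duality turns the quadratic upper bound on [sigma] near [y] into a quadratic lower bound on its
    conjugate near [p0], and on any bounded set after shrinking the constant. *)
Lemma gap_quadratic N : exists2 b, 0 < b & forall q c, enorm q <= N ->
  conjugate sigma q = c%:E -> b * dotp (q - p0) (q - p0) <= gap q c.
Proof.
have [B B0 HB] := bregman_quadratic sigma_C2 y 1.
pose L := `|N| + `|p0| + 1.
have L0 : 0 < L by rewrite ltr_wpDl// addr_ge0.
(* As [L] bounds the norm of [q - p0], the first term keeps the test point in the unit ball around
   [y] where [B] is valid. The second makes the loss [B * s ^+ 2] at most half of the gain [s],
   whence the constant [s / 2]. *)
pose s := Num.min L^-1 (2 * B)^-1.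
have s0 : 0 < s by rewrite lt_min !invr_gt0 L0 mulr_gt0.
have sL : s * L <= 1 by rewrite -ler_pdivlMr// div1r ge_min lexx.
have sB : s * (2 * B) <= 1.
  by rewrite -ler_pdivlMr ?mulr_gt0// div1r ge_min lexx orbT.
exists (s / 2); first by rewrite divr_gt0.
move=> q c qN qc.
(* Test the supremum defining [conjugate sigma q] at [y + s (q - p0)]. *)
have := HB (y + s *: (q - p0)).
rewrite /bregman -/p0 (addrC y) addrK !dotpZl dotpZr normrZ (gtr0_norm s0).
have qL : `|q - p0| <= L.
  apply: (le_trans (ler_normB _ _)); rewrite /L -addrA lerD//; last by rewrite lerDl.
  by apply: (le_trans (norm_le_enorm q)); rewrite (le_trans qN)// ler_norm.
have /[swap]/[apply] : s * `|q - p0| <= 1.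
  by apply: le_trans sL; rewrite ler_wpM2l// ltW.
have := conjugate_lb (s *: (q - p0) + y) q.
rewrite qc lee_fin (dotpDl (s *: (q - p0))) dotpZl.
have := dotp_ge0 (q - p0).
have : dotp (q - p0) (q - p0) = dotp (q - p0) q - dotp (q - p0) p0.
  by rewrite dotpDr dotpNr.
rewrite /gap ler_norml => Ed d0 h1 /andP[_ h2].
have h3 : s * dotp (q - p0) (q - p0) = s * dotp (q - p0) q - s * dotp (q - p0) p0.
  by rewrite Ed mulrBr.
have h4 : B * (s * (s * dotp (q - p0) (q - p0))) <= s / 2 * dotp (q - p0) (q - p0).
  rewrite !mulrA ler_wpM2r//; nra.
lra.
Qed.

Lemma type_I_small_time : exists2 d, 0 < d &
  forall t, 0 < t < d -> t <= T -> type_I H sigma y t (char_curve H sigma y t).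
Proof.
have T01 : 0 <= (0 : R) < T by rewrite lexx T_gt0.
have [r [N [r0 N0 HA]]] := A1 y T01.
have [b b0 Hb] := gap_quadratic N.
have [K K0 HK] := H_bregman_quadratic H_C2 p0 (N + `|p0|).
have [B B0 HB] := grad_time_bounded H_C2 p0.
have nB : 0 <= n%:R * B by rewrite mulr_ge0// ltW.
(* Below [b / K] the gap dominates the excess. Below the last bound the point of the curve stays in
   the (A1) neighbourhood of [(0, y)], since its displacement is at most [n%:R * B * t]. *)
exists (Num.min T (Num.min (b / K) (r / (1 + n%:R * B)))).
  by rewrite !lt_min T_gt0 !divr_gt0//; lra.
move=> t; rewrite !lt_min => /andP[t0 /and3P[tT]].
rewrite ltr_pdivlMr// ltr_pdivlMr; last by lra.
move=> tK tr _.
have tT' : 0 <= t <= T by lra.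
have near_y : `|t - 0| + enorm (char_curve H sigma y t - y) < r.
  rewrite subr0 (gtr0_norm t0) /char_curve -/p0 (addrC y) addrK.
  apply: le_lt_trans tr; rewrite mulrDr mulr1 lerD2l.
  apply: (le_trans (enorm_le_sum _)).
  apply: (@le_trans _ _ (\sum_(i < n) B * t)).
    apply: ler_sum => i _; rewrite mxE -[leLHS]/(`|oint 0 t _|).
    have := oint_lipschitz (s := 0) (grad_time_integrable H_C2 p0 i) (HB i).
    by move=> /(_ t); rewrite oint0 !subr0; apply; lra.
  by rewrite sumr_const card_ord -[leLHS]mulr_natl mulrA [leRHS]mulrC.
have small q : enorm q <= N ->
    (hopf_fun H sigma t (char_curve H sigma y t) q <=
     hopf_fun H sigma t (char_curve H sigma y t) p0)%E.
  move=> qN; apply/hopf_leP => // c qc.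
  have := Hb q c qN qc.
  have qN' : `|q - p0| <= N + `|p0|.
    by rewrite (le_trans (ler_normB _ _))// lerD2r (le_trans (norm_le_enorm _)).
  have := oint_lipschitz (s := 0) (bregman_time_integrable H_C2 p0 q)
    (fun s sT => HK s q sT qN').
  move=> /(_ t); rewrite oint0 !subr0 lexx (ltW t0) => /(_ isT (ltW tT)).
  rewrite -/(excess t q) ler_norml => /andP[h1 _] h2.
  have := dotp_ge0 (q - p0); nra.
move=> q; have [qN|Nq] := leP (enorm q) N; first exact: small.
(* A large [q] is beaten by the maximizer [q'] over the ball of radius [N], which in turn does no
   better than [p0]. *)
have [|m [[q' q'N <-] _] /ltW/le_trans] := HA t (char_curve H sigma y t) q _ near_y Nq.
  by rewrite (ltW t0).
by apply; exact: small.
Qed.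

(** For each [q], either the integrand is nonnegative, so the gap and the excess at [s] are both
    nonnegative, or it is nonpositive, so the excess decreases in time and is at least as large at
    [s] as at [t]. *)
Lemma type_I_down s t : 0 < s < t -> t < T ->
  type_I H sigma y t (char_curve H sigma y t) ->
  type_I H sigma y s (char_curve H sigma y s).
Proof.
move=> st tT.
have sT : 0 <= s <= T by lra.
have tT' : 0 <= t <= T by lra.
move=> /(type_IP tT') It; apply/(type_IP sT) => q c qc.
have := It q c qc; have := gap_ge0 qc.
have I a b : 0 <= a -> b <= T -> (@lebesgue_measure R).-integrable `[a, b]
    (EFin \o (fun r => bregman (H r) p0 q)).
  by move=> a0 bT; exact: integrable_segment (bregman_time_integrable H_C2 p0 q).
have [b0|b0] := bregman_sign p0 q.
  suff : 0 <= excess s q by lra.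
  have <- : oint 0 s (fun=> 0) = 0 by rewrite oint_cst ?mul0r//; lra.
  apply: le_oint; [lra|exact: integrable_cst|apply: I; lra|].
  by move=> r rs; apply: b0; lra.
suff : excess t q <= excess s q by lra.
rewrite -subr_le0 /excess -(oint_from0 (bregman_time_integrable H_C2 p0 q))//.
have <- : oint s t (fun=> 0) = 0 by rewrite oint_cst ?mul0r//; lra.
apply: le_oint; [lra|apply: I; lra|exact: integrable_cst|].
by move=> r rs; apply: b0; lra.
Qed.

(** For fixed [q] the excess is Lipschitz in time, so a violation at [t] would already occur shortly
    before [t]. *)
Lemma type_I_closed t : 0 < t < T ->
  (forall s, 0 < s < t -> type_I H sigma y s (char_curve H sigma y s)) ->
  type_I H sigma y t (char_curve H sigma y t).
Proof.
move=> tT It; apply/type_IP; first by lra.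
move=> q c qc.
have [K K0 HK] := H_bregman_quadratic H_C2 p0 `|q - p0|.
pose C := K * dotp (q - p0) (q - p0).
have HC s : 0 <= s <= T -> `|bregman (H s) p0 q| <= C by move=> sT; exact: HK.
have C0 : 0 <= C by rewrite mulr_ge0 ?dotp_ge0// ltW.
rewrite leNgt; apply/negP => neg.
pose e := - (gap q c + excess t q).
(* Between [s] and [t] the excess changes by at most [e / 2], too little to make up the deficit [e].
   The bound [t / 2] keeps [s] positive, and [C + 1] avoids dividing by zero. *)
pose s := Num.max (t / 2) (t - e / (2 * (C + 1))).
have e0 : 0 < e by rewrite oppr_gt0.
have s1 : t / 2 <= s by rewrite le_max lexx.
have s2 : t - e / (2 * (C + 1)) <= s by rewrite le_max lexx orbT.
have ec : 0 < e / (2 * (C + 1)) by rewrite divr_gt0//; lra.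
have s3 : s < t by rewrite gt_max; apply/andP; split; lra.
have sT : 0 <= s <= T by lra.
have /(type_IP sT)/(_ q c qc) : type_I H sigma y s (char_curve H sigma y s).
  by apply: It; lra.
have := oint_lipschitz (s := s) (t := t) (bregman_time_integrable H_C2 p0 q)
  HC ltac:(lra) ltac:(lra).
rewrite -/(excess t q) -/(excess s q) ler_norml => /andP[h1 _] h2.
have h3 : C * (t - s) <= C * (e / (2 * (C + 1))) by rewrite ler_wpM2l//; lra.
have h4 : C * (e / (2 * (C + 1))) <= e / 2.
  rewrite mulrA ler_pdivrMr; last by lra.
  nra.
have h5 := le_trans h3 h4.
have eE : e = - (gap q c + excess t q) by [].
lra.
Qed.

End type_I_times.

Theorem theorem2p11 (R : realType) (n : nat) (T : R)
    (H : R -> 'rV[R]_n -> R) (sigma : 'rV[R]_n -> R)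
    (T_gt0 : 0 < T)
    (sigma_convex : convex_function setT sigma)
    (A1 : condA1 H sigma T)
    (A2 : condA2 H T)
    (H_C2 : Ck_on 2 [set z : (R^o * 'rV[R]_n)%type | 0 <= z.1 <= T]
              (fun z => H z.1 z.2))
    (sigma_C2 : Ck_on 2 [set: 'rV[R]_n] sigma)
    (t0 : R) (x0 y0 : 'rV[R]_n)
    (t0_in : 0 < t0 < T)
    (y0_in : ell_star H sigma t0 x0 y0) :
  let x (t : R) := x0 + ointv t0 t (fun s => grad (H s) (grad sigma y0)) in
  type_II H sigma y0 t0 (x t0) ->
  exists theta : R,
    [/\ 0 < theta < t0,
        type_I H sigma y0 theta (x theta) &
        forall t, theta < t <= t0 -> type_II H sigma y0 t (x t)].
Proof.
move=> x.
(* The curve passes through [x0] at time [t0], so both descriptions of it agree on [0, T]. *)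
have xE t : 0 <= t <= T -> x t = char_curve H sigma y0 t.
  move=> tT; rewrite /x -y0_in /char_curve -addrA; congr (_ + _).
  apply/rowP => i; rewrite !mxE.
  rewrite (oint_from0 (grad_time_integrable H_C2 _ i) _ tT) ?subrKC//.
  lra.
rewrite xE; last by lra.
move=> [_ not_ell].
have [d d0 small] := type_I_small_time T_gt0 sigma_convex A1 H_C2 sigma_C2 y0.
have [t00 _] := andP t0_in.
have [||||theta [theta_in Itheta notI]] :=
  @last_time _ (fun t => type_I H sigma y0 t (char_curve H sigma y0 t)) d t0 d0 t00.
- by move=> t td tt0; apply: small => //; lra.
- move=> s t st tt0; apply: (type_I_down T_gt0 sigma_convex A2 H_C2 sigma_C2 st); lra.
- move=> t tt0; apply: (type_I_closed sigma_convex H_C2 sigma_C2); lra.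
- exact: not_ell.
exists theta; split; first exact: theta_in.
  by rewrite xE; [exact: Itheta|lra].
move=> t tt; rewrite xE; last by lra.
(* At each of its own points the curve has [y0] as a foot, so type (II) there amounts to the failure
   of type (I). *)
by split; [exists y0|exact: notI].
Qed.
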